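(* For each of the two merging operators $\Delta\in\{\Delta^{h},\Delta^{eh}\}$ (defined with hull revision and extended hull revision in the context) the following hold. Satisfied postulates. For every finite set $\mathcal V$ of propositional variables, every profile $\Phi$ and every program $P$ over $\mathcal V$: - (FP0) $\Delta_P(\Phi)\vdash P$; - (FP1) if $P$ is consistent, then $\Delta_P(\Phi)$ is consistent; - (FP2) if $C_{fc}(\bigcup\Phi\cup P)$ is consistent, then $\Delta_P(\Phi)=C_{fc}(\bigcup\Phi\cup P)$. Postulates not satisfied. Each of the following fails in general, i.e. for each of them there are a finite set $\mathcal V$, and profiles and programs over $\mathcal V$, violating it: - (FP3) if $\Phi_1=\{P_1,\dots,P_n\}$, $\Phi_2=\{Q_1,\dots,Q_n\}$, $C_{fc}(P_i)=C_{fc}(Q_i)$ for all $i$, and $C_{fc}(P)=C_{fc}(Q)$, then $\Delta_P(\Phi_1)=\Delta_Q(\Phi_2)$; - (FP4) if $P_1\vdash P$, $P_2\vdash P$ and $P_1$ and $P_2$ are consistent, then $C_{fc}(\Delta_P(P_1,P_2)\cup P_1)\neq \mathit{Lit}$ implies $C_{fc}(\Delta_P(P_1,P_2)\cup P_2)\neq \mathit{Lit}$; - (FP5) $\Delta_P(\Phi_1)\cup\Delta_P(\Phi_2)\vdash\Delta_P(\Phi_1\sqcup\Phi_2)$; - (FP6) if $\Delta_P(\Phi_1)\cup\Delta_P(\Phi_2)$ is consistent, then $\Delta_P(\Phi_1\sqcup\Phi_2)\vdash\Delta_P(\Phi_1)\cup\Delta_P(\Phi_2)$; - (FP7) $\Delta_P(\Phi)\cup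 Q\vdash\Delta_{P\cup Q}(\Phi)$; - (FP8) if $\Delta_P(\Phi)\cup Q$ is consistent, then $\Delta_{P\cup Q}(\Phi)\vdash\Delta_P(\Phi)\cup Q$.
   Context: Programs. Let $\mathcal V$ be a finite set of propositional variables (atoms). A literal (or fact) is an atom or the negation of an atom; $\mathit{Lit}$ is the set of literals. An atom and its negation are called opposed. A rule is a formula $l_1,\dots,l_n\to l_{n+1}$ with all $l_i$ literals; $\{l_1,\dots,l_n\}$ is its body and $l_{n+1}$ its head; a fact $l$ is regarded as a rule $\to l$ with empty body. A program is a set $R\cup L$ with $R$ a finite set of rules with nonempty body and $L$ a finite set of facts. In particular a set of literals is a program. Consequences. For a program $P=R\cup L$, $C_{fc}(P)$ is the smallest set of literals $L'$ (for inclusion) such that (i) $L\subseteq L'$; (ii) if $l_1,\dots,l_n\to l$ is in $R$ and $l_1,\dots,l_n\in L'$ then $l\in L'$; (iii) if $L'$ contains two opposed literals then $L'=\mathit{Lit}$. $P$ is consistent if $C_{fc}(P)$ does not contain two opposed literals, and inconsistent otherwise. A program (or set of literals) $Q$ is $P$-consistent (consistent with $P$) if $Q\cup P$ is consistent. Entailment: $P\vdash Q$ means $C_{fc}(Q)\subseteq C_{fc}(P)$. Base and rank. A rule of $P$ with body $L$ is exceptional for $P$ if $L\cup P$ is inconsistent. Put $P_0=P$ and let $P_{i+1}$ be the set of exceptional rules of $P_i$. Let $n_0$ be the first integer such that $P_m=P_{n_0}$ for all $m>n_0$. The base of $P$ is $\langle P_0,\dots,P_{n_0}\rangle$ if $P_{n_0}=\emptyset$,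 and $\langle P_0,\dots,P_{n_0},\emptyset\rangle$ otherwise. Write the base as $\langle P_0,\dots,P_n\rangle$ (so $P_n=\emptyset$). The rank is $\rho(P,Q)=\min\{i: Q \text{ is } P_i\text{-consistent}\}$ if $P$ and $Q$ are both consistent, and $\rho(P,Q)=n$ otherwise; here $P_i$ denotes the $i$-th entry of the base. Revision operators. For programs $P,P'$: - $I_P(P')$ is the set of subsets of $P$ that are consistent with $P'$, contain $P_{\rho(P,P')}$ (entry of the base of $P$), and are maximal (for inclusion) with these properties. Let $h_P(P')=\bigcap I_P(P')$ (an intersection of subsets of $P$; if $I_P(P')=\emptyset$, it is taken to be $P$). Hull revision: $P\circ_{h}P'=h_P(P')\cup P'$. - Extended hull revision: $P\circ_{eh}P'=\langle H_1\cup P',\dots,H_n\cup P'\rangle$ if $I_P(P')=\{H_1,\dots,H_n\}\neq\emptyset$, and $P\circ_{eh}P'=P'$ if $I_P(P')=\emptyset$. For a finite vector of programs, $C_{fc}(\langle Q_1,\dots,Q_n\rangle)=\bigcap_{i=1}^n C_{fc}(Q_i)$. Merging. A profile is a finite nonempty multiset $\Phi=\{P_1,\dots,P_n\}$ of nonempty programs; $\bigcup\Phi$ is the union of its programs, and $\sqcup$ is multiset union. For $x\in\{h,eh\}$, a profile $\{P_1,\dots,P_n\}$ and a program $P$ (the integrity constraint), $\Delta^{x}_P(P_1,\dots,P_n)$, also written $\Delta^{x}_P(\Phi)$, is the set of literals equal to $C_{fc}(P\cup P_1\cup\dots\cup P_n)$ if this is consistent, and to $\bigcap_{i=1}^n C_{fc}(P_i\circ_{x}P)$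 otherwise. *)

(* Defs.v *)
From mathcomp Require Export all_boot.
From mathcomp Require Export finmap multiset.

Set Implicit Arguments.
Unset Strict Implicit.
Unset Printing Implicit Defensive.

(* [(a, true)] is the atom [a], [(a, false)] is its negation. *)
Definition lit (V : finType) : finType := (V * bool)%type.

Definition opp (V : finType) (l : lit V) : lit V := (l.1, ~~ l.2).

Definition opposed_in (V : finType) (L : {set lit V}) : bool :=
  [exists l in L, opp l \in L].

(* A rule is the pair (body, head); a fact is a rule with empty body, so that
   a program R u L (rules with nonempty body, facts) is one set of such pairs. *)
Definition rule (V : finType) : finType := ({set lit V} * lit V)%type.
Definition body (V : finType) (r : rule V) : {set lit V} := r.1.
Definition head (V : finType) (r : rule V) : lit V := r.2.

Definition program (V : finType) : finType := {set rule V}.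

Definition fact (V : finType) (l : lit V) : rule V := (set0, l).

(* A set of literals, seen as a program. *)
Definition facts (V : finType) (L : {set lit V}) : program V :=
  [set fact l | l in L].

Section Consequences.
Variable V : finType.
Implicit Types (P Q : program V) (L : {set lit V}).

(* On rules with empty body the first conjunct says that the facts of P are
   in L. *)
Definition fc_closed P L : bool :=
  [forall r in P, (body r \subset L) ==> (head r \in L)]
  && (opposed_in L ==> (L == [set: lit V])).

(* The smallest closed set: see [Cfc_closed] and [Cfc_min]. *)
Definition Cfc P : {set lit V} := \bigcap_(L | fc_closed P L) L.

Lemma Cfc_min P L : fc_closed P L -> Cfc P \subset L.
Proof. by move=> cL; apply: bigcap_inf. Qed.

Lemma Cfc_closed P : fc_closed P (Cfc P).
Proof.
apply/andP; split.
  apply/forallP => r; apply/implyP => rP; apply/implyP => /subsetP bC.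
  apply/bigcapP => L cL; case/andP: (cL) => /forallP/(_ r).
  rewrite rP /= => /implyP H _; apply: H.
  by apply/subsetP => l /bC /bigcapP/(_ L cL).
apply/implyP => /existsP[l /andP[lC olC]]; rewrite eqEsubset subsetT /=.
apply/subsetP => l' _; apply/bigcapP => L cL; case/andP: (cL) => _ /implyP H.
rewrite (eqP (H _)) ?inE //; apply/existsP; exists l.
by rewrite (bigcapP lC) // (bigcapP olC).
Qed.

Definition consistent P : bool := ~~ opposed_in (Cfc P).

(* P |- Q *)
Definition entails P Q : bool := Cfc Q \subset Cfc P.

Definition exceptional P (r : rule V) : bool :=
  ~~ consistent (facts (body r) :|: P).

Definition exc P : program V := [set r in P | exceptional P r].

(* The sequence P_0, P_1, ... *)
Definition level P (i : nat) : program V := iter i exc P.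

Definition stable P (k : nat) : Prop :=
  forall m, k < m -> level P m = level P k.

Lemma stable_next P k : level P k.+1 = level P k <-> stable P k.
Proof.
split=> [e | /(_ k.+1)]; last exact.
elim=> // m IHm; rewrite ltnS leq_eqVlt => /predU1P[<- // | /IHm e'].
by rewrite -[RHS]e /level !iterS -!/(level _ _) e'.
Qed.

Lemma stable_dec P k : decidable (stable P k).
Proof.
case: (level P k.+1 =P level P k) => [/stable_next | ne]; first by left.
by right => /stable_next.
Qed.

Lemma exists_stable P : exists k, stable_dec P k : bool.
Proof.
suff: exists k, level P k.+1 = level P k.
  by case=> k /stable_next s; exists k; case: (stable_dec P k).
have [n leP] := ubnP #|P|; elim: n P leP => // n IHn P leP.
have sP : exc P \subset P by apply/subsetP => r; rewrite inE => /andP[].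
case: (eqVneq (exc P) P) => [e | ne]; first by exists 0.
case: (IHn (exc P)) => [|k e]; last first.
  by exists k.+1; move: e; rewrite /level !iterSr.
apply: (@leq_trans #|P|); last by rewrite -ltnS.
by apply: proper_card; rewrite properEneq ne.
Qed.

(* The first k such that P_m = P_k for all m > k. *)
Definition stab_index P : nat := ex_minn (exists_stable P).

Definition base P : seq (program V) :=
  let n0 := stab_index P in
  let s := [seq level P i | i <- iota 0 n0.+1] in
  if level P n0 == set0 then s else rcons s set0.

Definition base_nth P (i : nat) : program V := nth set0 (base P) i.

(* [find] is the least index whose entry is consistent with Q; it exists since
   the last entry of the base is empty.  The last index of the base is
   [(size (base P)).-1]. *)
Definition rank P Q : nat :=
  if consistent P && consistent Q
  then find (fun Pi => consistent (Q :|: Pi)) (base P)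
  else (size (base P)).-1.

Definition hull_family P P' : {set program V} :=
  [set H : program V |
    maxset (fun K : program V =>
      [&& K \subset P, consistent (K :|: P')
        & base_nth P (rank P P') \subset K]) H].

Definition hull P P' : program V :=
  let I := hull_family P P' in
  if I == set0 then P else \bigcap_(H in I) H.

Definition hull_rev P P' : program V := hull P P' :|: P'.

(* A finite vector of programs. *)
Definition ehull_rev P P' : seq (program V) :=
  let I := hull_family P P' in
  if I == set0 then [:: P'] else [seq H :|: P' | H : program V <- enum I].

Definition Cfc_vec (s : seq (program V)) : {set lit V} :=
  \bigcap_(Q <- s) Cfc Q.

End Consequences.

Variant revision := Hull | ExtHull.

(* Cfc (P o_x P') *)
Definition Cfc_rev (x : revision) (V : finType) (P P' : program V) :
    {set lit V} :=
  match x with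
  | Hull => Cfc (hull_rev P P')
  | ExtHull => Cfc_vec (ehull_rev P P')
  end.

Local Open Scope mset_scope.

Definition profile (V : finType) (Phi : {mset program V}) : Prop :=
  Phi <> mset0 /\ (forall P : program V, P \in Phi -> P <> set0).

Definition union (V : finType) (Phi : {mset program V}) : program V :=
  \bigcup_(Q <- Phi) Q.

(* The set of literals Delta^x_P(Phi). *)
Definition delta (x : revision) (V : finType)
    (P : program V) (Phi : {mset program V}) : {set lit V} :=
  if consistent (facts (Cfc (P :|: union Phi)))
  then Cfc (P :|: union Phi)
  else \bigcap_(Q <- Phi) Cfc_rev x Q P.

Section Postulates.
Variable V : finType.
Variable D : program V -> {mset program V} -> {set lit V}.

Definition FP0 : Prop := forall Phi P,
  profile Phi -> entails (facts (D P Phi)) P.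

Definition FP1 : Prop := forall Phi P,
  profile Phi -> consistent P -> consistent (facts (D P Phi)).

Definition FP2 : Prop := forall Phi P,
  profile Phi -> consistent (facts (Cfc (union Phi :|: P))) ->
  D P Phi = Cfc (union Phi :|: P).

Definition FP3 : Prop :=
  forall (n : nat) (Ps Qs : n.-tuple (program V)) (P Q : program V),
  profile (seq_mset Ps) -> profile (seq_mset Qs) ->
  (forall i : 'I_n, Cfc (tnth Ps i) = Cfc (tnth Qs i)) ->
  Cfc P = Cfc Q ->
  D P (seq_mset Ps) = D Q (seq_mset Qs).

Definition FP4 : Prop := forall P1 P2 P : program V,
  profile [mset P1; P2] ->
  entails P1 P -> entails P2 P -> consistent P1 -> consistent P2 ->
  Cfc (facts (D P [mset P1; P2]) :|: P1) <> [set: lit V] ->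
  Cfc (facts (D P [mset P1; P2]) :|: P2) <> [set: lit V].

Definition FP5 : Prop := forall Phi1 Phi2 P,
  profile Phi1 -> profile Phi2 ->
  entails (facts (D P Phi1 :|: D P Phi2)) (facts (D P (Phi1 `+` Phi2))).

Definition FP6 : Prop := forall Phi1 Phi2 P,
  profile Phi1 -> profile Phi2 ->
  consistent (facts (D P Phi1 :|: D P Phi2)) ->
  entails (facts (D P (Phi1 `+` Phi2))) (facts (D P Phi1 :|: D P Phi2)).

Definition FP7 : Prop := forall Phi P Q,
  profile Phi ->
  entails (facts (D P Phi) :|: Q) (facts (D (P :|: Q) Phi)).

Definition FP8 : Prop := forall Phi P Q,
  profile Phi -> consistent (facts (D P Phi) :|: Q) ->
  entails (facts (D (P :|: Q) Phi)) (facts (D P Phi) :|: Q).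

End Postulates.

(* Main.v *)
(* FP0 and FP1 hold because every component of a revision contains the
   constraint P, and because some subset of each program (an entry of its base,
   the last one being empty) is consistent with P, so that a maximal one exists.

   FP3 to FP8 fail on programs over two atoms a, b, chosen so that every
   revision has a single maximal consistent subset, which makes the two
   operators agree:
   FP3: {a, b} and {a, a -> b} under ~a keep b or lose it;
   FP4: {~a} and {a, b} under {a -> ~a, b -> ~a}, merged to {~a};
   FP5: {a} and {a -> b} under the empty constraint, and FP7: {a -> b} to which
   a is added, because merging literals forgets the rule;
   FP6: {a} and {a -> ~a}, merged to the empty set;
   FP8: {a} under {b -> ~a}, to which b is added. *)
Require Import Defs.

Set Implicit Arguments.
Unset Strict Implicit.
Unset Printing Implicit Defensive.

Local Open Scope mset_scope.

(** * Forward-chaining closure and consistency *)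

Lemma Cfc_fires (V : finType) (P : program V) (r : rule V) :
  r \in P -> body r \subset Cfc P -> head r \in Cfc P.
Proof.
by move=> rP; case/andP: (Cfc_closed P) => /forall_inP/(_ r rP)/implyP.
Qed.

Lemma Cfc_fact (V : finType) (P : program V) (l : lit V) :
  fact l \in P -> l \in Cfc P.
Proof. by move=> lP; apply: (Cfc_fires lP); rewrite sub0set. Qed.

Lemma Cfc_rule (V : finType) (P : program V) (l m : lit V) :
  ([set l], m) \in P -> l \in Cfc P -> m \in Cfc P.
Proof. by move=> rP lC; apply: (Cfc_fires rP); rewrite sub1set. Qed.

Lemma Cfc_mono (V : finType) (P Q : program V) :
  P \subset Q -> Cfc P \subset Cfc Q.
Proof.
move=> sPQ; apply: Cfc_min; case/andP: (Cfc_closed Q) => clQ opQ.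
apply/andP; split=> //; apply/forall_inP => r rP.
exact: (forall_inP clQ) r (subsetP sPQ r rP).
Qed.

Lemma opposed_inS (V : finType) (L M : {set lit V}) :
  L \subset M -> opposed_in L -> opposed_in M.
Proof.
move=> sLM /exists_inP[l lL olL]; apply/exists_inP.
by exists l; rewrite (subsetP sLM).
Qed.

Lemma consistentS (V : finType) (P Q : program V) :
  P \subset Q -> consistent Q -> consistent P.
Proof. by move=> sPQ; apply: contra; apply: opposed_inS (Cfc_mono sPQ). Qed.

Lemma inconsistentP (V : finType) (P : program V) (l : lit V) :
  l \in Cfc P -> opp l \in Cfc P -> ~~ consistent P.
Proof. by move=> lP olP; rewrite negbK; apply/exists_inP; exists l. Qed.

Lemma inconsistent_Cfc (V : finType) (P : program V) :
  ~~ consistent P -> Cfc P = [set: lit V].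
Proof.
by rewrite negbK => opP; case/andP: (Cfc_closed P) => _ /implyP/(_ opP)/eqP.
Qed.

Lemma sub_Cfc_facts (V : finType) (L : {set lit V}) : L \subset Cfc (facts L).
Proof. by apply/subsetP => l lL; apply/Cfc_fact/imset_f. Qed.

(** [Cfc P] already contains the added facts, so it is closed for the enlarged program as well. *)
Lemma Cfc_factsU (V : finType) (P : program V) (L : {set lit V}) :
  L \subset Cfc P -> Cfc (facts L :|: P) = Cfc P.
Proof.
move=> sLP; apply/eqP; rewrite eqEsubset (Cfc_mono (subsetUr _ _)) andbT.
apply: Cfc_min; case/andP: (Cfc_closed P) => /forall_inP clP opP.
apply/andP; split=> //; apply/forall_inP => r /setUP[/imsetP[l lL ->] | /clP //].
by apply/implyP => _; apply: (subsetP sLP).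
Qed.

Lemma Cfc_facts_sub (V : finType) (P : program V) (L : {set lit V}) :
  L \subset Cfc P -> Cfc (facts L) \subset Cfc P.
Proof. by move=> sLP; rewrite -(Cfc_factsU sLP) Cfc_mono ?subsetUl. Qed.

Lemma Cfc_facts_Cfc (V : finType) (P : program V) :
  Cfc (facts (Cfc P)) = Cfc P.
Proof. by apply/eqP; rewrite eqEsubset Cfc_facts_sub ?sub_Cfc_facts. Qed.

Lemma consistent_facts_Cfc (V : finType) (P : program V) :
  consistent (facts (Cfc P)) = consistent P.
Proof. by rewrite /consistent Cfc_facts_Cfc. Qed.

(** A list closed under the rules and free of opposed literals is one of the sets intersected in
    [Cfc P]. For a concrete program this bounds the closure from above by a finite check. *)
Lemma Cfc_sub_seq (V : finType) (P : program V) (s : seq (lit V)) :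
  (forall r, r \in P -> body r \subset [set x in s] -> head r \in s) ->
  all (fun l => opp l \notin s) s -> Cfc P \subset [set x in s].
Proof.
move=> clP /allP con; apply: Cfc_min; apply/andP; split.
  by apply/forall_inP => r rP; apply/implyP => /(clP r rP); rewrite inE.
apply/implyP => /exists_inP[l]; rewrite !inE => /con /negPf.
by move=> ->.
Qed.

Lemma consistent_sub_seq (V : finType) (P : program V) (s : seq (lit V)) :
  Cfc P \subset [set x in s] -> all (fun l => opp l \notin s) s -> consistent P.
Proof.
move=> sub con; apply: contra (opposed_inS sub) _.
by apply/exists_inP => -[l]; rewrite !inE => /(allP con) /negPf->.
Qed.

Lemma consistent_seq (V : finType) (P : program V) (s : seq (lit V)) :
  (forall r, r \in P -> body r \subset [set x in s] -> head r \in s) ->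
  all (fun l => opp l \notin s) s -> consistent P.
Proof. by move=> clP con; apply: (consistent_sub_seq (Cfc_sub_seq clP con)). Qed.

Lemma Cfc_factsU_sub_seq (V : finType) (L : {set lit V}) (P : program V)
    (s : seq (lit V)) :
  L \subset [set x in s] ->
  (forall r, r \in P -> body r \subset [set x in s] -> head r \in s) ->
  all (fun l => opp l \notin s) s -> Cfc (facts L :|: P) \subset [set x in s].
Proof.
move=> sL clP; apply: Cfc_sub_seq => r /setUP[/imsetP[l lL ->] _ | /clP //].
by have := subsetP sL l lL; rewrite inE.
Qed.

Lemma Cfc_facts_sub_seq (V : finType) (L : {set lit V}) (s : seq (lit V)) :
  L \subset [set x in s] ->
  all (fun l => opp l \notin s) s -> Cfc (facts L) \subset [set x in s].
Proof.
move=> sL; rewrite -(setU0 (facts L)); apply: Cfc_factsU_sub_seq => // r.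
by rewrite inE.
Qed.

(** * Base and rank *)

Lemma exc_sub (V : finType) (P : program V) : exc P \subset P.
Proof. by apply/subsetP => r; rewrite inE => /andP[]. Qed.

Lemma level_sub (V : finType) (P : program V) i : level P i \subset P.
Proof.
by elim: i => //= i IHi; apply: subset_trans (exc_sub _) IHi.
Qed.

Lemma base_nth_sub (V : finType) (P : program V) i : base_nth P i \subset P.
Proof.
have sub Q : Q \in base P -> Q \subset P.
  have lvl : Q \in [seq level P i | i <- iota 0 (stab_index P).+1] ->
      Q \subset P by case/mapP => k _ ->; apply: level_sub.
  rewrite /base; case: ifP => _ //; rewrite mem_rcons inE => /predU1P[->|//].
  exact: sub0set.
rewrite /base_nth; have [lt_i | ge_i] := ltnP i (size (base P)).
  by apply: sub; apply: mem_nth.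
by rewrite nth_default ?sub0set.
Qed.

Lemma size_base_gt0 (V : finType) (P : program V) : 0 < size (base P).
Proof. by rewrite /base; case: ifP => _; rewrite ?size_rcons. Qed.

Lemma base_last (V : finType) (P : program V) :
  base_nth P (size (base P)).-1 = set0.
Proof.
rewrite /base_nth nth_last /base; case: ifP => [/eqP e | _].
  (* No empty set is appended here: the last entry is the level at the stabilization index, empty by
     [e]. *)
  by rewrite -[RHS]e -addn1 iotaD map_cat last_cat.
by rewrite last_rcons.
Qed.

Lemma base_rank_consistent (V : finType) (Q P : program V) :
  consistent P -> consistent (base_nth Q (rank Q P) :|: P).
Proof.
(* If [Q] is inconsistent, the rank is the last index, whose entry is empty. Otherwise that same
   empty entry ensures that [find] succeeds. *)
move=> conP; rewrite /rank conP andbT; case: ifP => _; last first.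
  by rewrite base_last set0U.
rewrite setUC; apply: (@nth_find _ set0 (fun Pi => consistent (P :|: Pi))).
apply/hasP; exists (base_nth Q (size (base Q)).-1).
  by apply: mem_nth; rewrite prednK ?size_base_gt0.
by rewrite base_last setU0.
Qed.

(** * Maximal consistent subsets and the two revisions *)

Lemma hull_family_neq0 (V : finType) (Q P : program V) :
  consistent P -> hull_family Q P != set0.
Proof.
move=> conP; pose B := base_nth Q (rank Q P).
pose ok (K : program V) := [&& K \subset Q, consistent (K :|: P) & B \subset K].
(* The base entry selected by the rank is itself admissible, so some maximal admissible set lies
   above it. *)
have okB : ok B by rewrite /ok base_nth_sub base_rank_consistent /=.
by have [H maxH _] := maxset_exists okB; apply/set0Pn; exists H; rewrite inE.
Qed.

Lemma hull_family_consistent (V : finType) (Q P H : program V) :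
  H \in hull_family Q P -> consistent (H :|: P).
Proof. by rewrite inE => /maxsetp /and3P[]. Qed.

Lemma Cfc_rev_ge (x : revision) (V : finType) (Q P : program V) :
  Cfc P \subset Cfc_rev x Q P.
Proof.
case: x => /=; first exact/Cfc_mono/subsetUr.
rewrite /Cfc_vec /ehull_rev; case: ifP => _; first by rewrite big_seq1.
rewrite big_map bigcap_seq; apply/bigcapsP => H _; exact/Cfc_mono/subsetUr.
Qed.

(** The hull is contained in each maximal set, and the extended revision intersects the closures
    over all of them; so any one of them bounds both operators. *)
Lemma Cfc_rev_le (x : revision) (V : finType) (Q P H : program V) :
  H \in hull_family Q P -> Cfc_rev x Q P \subset Cfc (H :|: P).
Proof.
move=> IH; have I0 : hull_family Q P != set0 by apply/set0Pn; exists H.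
case: x => /=.
  by rewrite /hull_rev /hull (negPf I0) Cfc_mono ?setSU ?bigcap_inf.
rewrite /Cfc_vec /ehull_rev (negPf I0) big_map bigcap_seq.
by apply: bigcap_inf; rewrite mem_enum.
Qed.

(* A single maximal set is both the hull and the only component of the extended
   hull.  The entry of the base that it must contain is itself consistent with
   [P], so the base need not be computed. *)
Lemma Cfc_rev_greatest (x : revision) (V : finType) (Q P H : program V) :
  H \subset Q -> consistent (H :|: P) ->
  (forall K : program V, K \subset Q -> consistent (K :|: P) -> K \subset H) ->
  Cfc_rev x Q P = Cfc (H :|: P).
Proof.
move=> sHQ conH maxH; have conP := consistentS (subsetUr H P) conH.
have eI : hull_family Q P = [set H].
  have HI : [&& H \subset Q, consistent (H :|: P)
              & base_nth Q (rank Q P) \subset H].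
    by rewrite sHQ conH maxH ?base_nth_sub ?base_rank_consistent.
  (* A maximal [K] lies below the admissible set [H], hence equals it; conversely [H] is maximal
     because it is greatest. *)
  apply/setP => K; rewrite !inE; apply/maxsetP/eqP => [[/and3P[sK cK _] max]|->].
    by apply/esym/max => //; apply: maxH.
  split=> // K' /and3P[sK cK _] sHK.
  by apply/eqP; rewrite eqEsubset sHK maxH.
have I0 : hull_family Q P != set0 by apply: hull_family_neq0.
case: x => /=; first by rewrite /hull_rev /hull (negPf I0) eI big_set1.
by rewrite /Cfc_vec /ehull_rev (negPf I0) eI enum_set1 big_seq1.
Qed.

Lemma Cfc_rev_consistent (x : revision) (V : finType) (Q P : program V) :
  consistent (Q :|: P) -> Cfc_rev x Q P = Cfc (Q :|: P).
Proof. by move=> con; apply: Cfc_rev_greatest. Qed.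

(** No subset consistent with [P] can contain [r], so [H] is the greatest such subset. *)
Lemma Cfc_rev_drop (x : revision) (V : finType) (H P : program V) (r : rule V) :
  ~~ consistent (r |: P) -> consistent (H :|: P) ->
  Cfc_rev x (r |: H) P = Cfc (H :|: P).
Proof.
move=> bad con; apply: Cfc_rev_greatest => // [|K sK conK]; first exact: subsetUr.
apply/subsetP => l lK; case/setU1P: (subsetP sK l lK) => // e; case/negP: bad.
by apply: consistentS conK; rewrite setSU ?sub1set -?e.
Qed.

(** * Merging profiles of one or two programs *)

Lemma delta_case (x : revision) (V : finType) (P : program V) Phi :
  delta x P Phi = if consistent (P :|: union Phi) then Cfc (P :|: union Phi)
                  else \bigcap_(Q <- Phi) Cfc_rev x Q P.
Proof. by rewrite /delta consistent_facts_Cfc. Qed.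

(** The enumeration order of a multiset is not known; a permutation suffices to compute unions and
    intersections over it. *)
Lemma mset2_perm (T : choiceType) (a b : T) :
  perm_eq [mset a; b] [:: a; b].
Proof.
apply/allP => c _; rewrite /= count_mem_mset mset1DE msetnE addn0 !(eq_sym c).
by case: (b == c).
Qed.

(** Both branches of [delta] agree here: when [Q] is consistent with [P], revision keeps all of
    [Q]. *)
Lemma delta1 (x : revision) (V : finType) (P Q : program V) :
  delta x P [mset Q] = Cfc_rev x Q P.
Proof.
rewrite delta_case /union enum_msetn !big_seq1; case: ifP => // con.
by rewrite Cfc_rev_consistent setUC.
Qed.

Lemma delta2 (x : revision) (V : finType) (P Q1 Q2 : program V) :
  delta x P [mset Q1; Q2] =
    if consistent (P :|: (Q1 :|: Q2)) then Cfc (P :|: (Q1 :|: Q2))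
    else Cfc_rev x Q1 P :&: Cfc_rev x Q2 P.
Proof.
rewrite delta_case /union !(perm_big _ (mset2_perm Q1 Q2)) /=.
by rewrite 2!big_cons big_nil setU0 2!big_cons big_nil setIT.
Qed.

Lemma profile1 (V : finType) (Q : program V) (r : rule V) :
  r \in Q -> profile [mset Q].
Proof.
move=> rQ; split=> [e | P]; first by have := in_mset1 Q Q; rewrite e in_mset0 eqxx.
by rewrite in_mset1 => /eqP-> Q0; rewrite Q0 inE in rQ.
Qed.

Lemma profile2 (V : finType) (P Q : program V) (r s : rule V) :
  r \in P -> s \in Q -> profile [mset P; Q].
Proof.
move=> rP sQ; split=> [e | _ /mset2P[] -> e0].
- by have := mset21 P Q; rewrite e in_mset0.
- by rewrite e0 inE in rP.
- by rewrite e0 inE in sQ.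
Qed.

(** * The satisfied postulates *)

Lemma delta_FP0 (x : revision) (V : finType) : FP0 (@delta x V).
Proof.
move=> Phi P _; apply: subset_trans (sub_Cfc_facts _).
rewrite delta_case; case: ifP => _; first exact/Cfc_mono/subsetUl.
by rewrite bigcap_seq; apply/bigcapsP => Q _; apply: Cfc_rev_ge.
Qed.

Lemma delta_FP1 (x : revision) (V : finType) : FP1 (@delta x V).
Proof.
move=> Phi P [Phi0 _] conP; rewrite delta_case.
case: ifP => con; first by rewrite consistent_facts_Cfc.
have [Q QPhi] : exists Q, Q \in Phi.
  case e: (enum_mset Phi) => [|Q s]; last first.
    by exists Q; rewrite -topredE /= e mem_head.
  by case: Phi0; rewrite -[LHS]seq_mset_id -[RHS]seq_mset_id e enum_mset0.
(* One program [Q] of the profile and one maximal [H] suffice: the merged set lies in the consistent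
   closure of [H :|: P]. *)
have /set0Pn[H HI] := hull_family_neq0 Q conP.
apply: contra (opposed_inS _) (hull_family_consistent HI).
apply: Cfc_facts_sub; apply: subset_trans (Cfc_rev_le x HI).
by rewrite bigcap_seq; apply: bigcap_inf.
Qed.

Lemma delta_FP2 (x : revision) (V : finType) : FP2 (@delta x V).
Proof.
by move=> Phi P _; rewrite consistent_facts_Cfc setUC delta_case => ->.
Qed.


(** * Counterexamples over two atoms: [true] stands for a, [false] for b *)

Local Notation pa := ((true, true) : lit bool).
Local Notation na := ((true, false) : lit bool).
Local Notation pb := ((false, true) : lit bool).
Local Notation "l ~> m" := (([set l], m) : rule bool) (at level 70).

Local Ltac member := by rewrite !inE eqxx ?orbT.

Local Ltac by_fact := apply: Cfc_fact; member.

Local Tactic Notation "by_rule" constr(l) :=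
  apply: (@Cfc_rule _ _ l); [member | by_fact].

(** Runs through the rules of an explicit program; bodies are empty or singletons, so inclusion of a
    body in the list reduces to membership. *)
Local Ltac closed :=
  rewrite ?setU0 ?set0U => r; rewrite !inE; repeat case/orP; move/eqP->;
  by rewrite /= ?sub1set ?inE.

Lemma delta_not_FP3 (x : revision) : ~ FP3 (@delta x bool).
Proof.
pose A : program bool := [set fact pa; fact pb].
pose B : program bool := [set fact pa; pa ~> pb].
pose P : program bool := [set fact na].
have CE (C : program bool) : fact pa \in C -> pb \in Cfc C ->
    (forall r, r \in C -> head r \in [:: pa; pb]) ->
    Cfc C = [set l in [:: pa; pb]].
  move=> aC bC hC; apply/eqP; rewrite eqEsubset Cfc_sub_seq //=; last first.
    by move=> r /hC.
  by apply/subsetP => l; rewrite !inE => /orP[] /eqP-> //; apply: Cfc_fact.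
have eC : Cfc A = Cfc B.
  rewrite (CE A); first rewrite (CE B); first by [].
  - member.
  - by_rule pa.
  - by move=> r; rewrite !inE => /orP[] /eqP->.
  - member.
  - by_fact.
  - by move=> r; rewrite !inE => /orP[] /eqP->.
have seq1 (C : program bool) : seq_mset [:: C] = [mset C].
  by rewrite -[RHS]seq_mset_id enum_msetn.
have bad : ~~ consistent (fact pa |: P).
  by apply: (@inconsistentP _ _ pa); by_fact.
move=> /(_ 1 [tuple A] [tuple B] P P); rewrite /= !seq1 !delta1.
(* Both programs lose the fact a: the first keeps the fact b, the second only a rule that can no
   longer fire. *)
rewrite (Cfc_rev_drop x bad); last first.
  by apply: (@consistent_seq _ _ [:: pb; na]) => //; closed.
rewrite (Cfc_rev_drop x bad); last first.
  by apply: (@consistent_seq _ _ [:: na]) => //; closed.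
move=> H; have: pb \in Cfc ([set pa ~> pb] :|: P).
  rewrite -H //; first by_fact.
  - by apply: (profile1 (r := fact pa)); member.
  - by apply: (profile1 (r := fact pa)); member.
  - by move=> i; rewrite !(tnth_nth set0) !ord1.
have: Cfc ([set pa ~> pb] :|: P) \subset [set l in [:: na]].
  by apply: Cfc_sub_seq => //; closed.
by move=> /subsetP sub /sub; rewrite !inE.
Qed.

Lemma delta_not_FP4 (x : revision) : ~ FP4 (@delta x bool).
Proof.
pose P : program bool := [set pa ~> na; pb ~> na].
pose P1 : program bool := [set fact na].
pose P2 : program bool := [set fact pa; fact pb].
have bad : ~~ consistent (fact pa |: P).
  by apply: (@inconsistentP _ _ pa); [by_fact | by_rule pa].
(* Without facts the constraint derives nothing, so both programs entail it. *)
have CP : Cfc P = set0.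
  apply/eqP; rewrite -subset0 (_ : set0 = [set l in [::]]); last first.
    by apply/setP => l; rewrite !inE.
  by apply: Cfc_sub_seq => //; closed.
have DE : delta x P [mset P1; P2] = Cfc (P1 :|: P) :&: Cfc ([set fact pb] :|: P).
  rewrite delta2 ifN; last by apply: (@inconsistentP _ _ pa); by_fact.
  rewrite Cfc_rev_consistent; last first.
    by apply: (@consistent_seq _ _ [:: na]) => //; closed.
  rewrite (Cfc_rev_drop x bad) //.
  by apply: (@consistent_seq _ _ [:: pb; na]) => //; closed.
(* The negation of a is a fact of [P1], and follows from the surviving fact b of [P2] by a rule of
   the constraint. *)
have naD : na \in delta x P [mset P1; P2].
  by rewrite DE inE; apply/andP; split; [by_fact | by_rule pb].
have D : delta x P [mset P1; P2] \subset Cfc P1.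
  rewrite DE (subset_trans (subsetIl _ _)) //.
  apply: (@subset_trans _ _ [set l in [:: na]]).
    by apply: Cfc_sub_seq => //; closed.
  by apply/subsetP => l; rewrite !inE => /eqP->; by_fact.
have con1 : consistent P1.
  by apply: (@consistent_seq _ _ [:: na]) => //; closed.
move=> /(_ P1 P2 P); apply=> //.
- by apply: (profile2 (r := fact na) (s := fact pa)); member.
- by rewrite /entails CP sub0set.
- by rewrite /entails CP sub0set.
- by apply: (@consistent_seq _ _ [:: pa; pb]) => //; closed.
- move=> full; apply: negP con1; apply: (@inconsistentP _ _ pa).
    by rewrite -(Cfc_factsU D) full inE.
  by rewrite -(Cfc_factsU D) full inE.
- apply: inconsistent_Cfc; apply: (@inconsistentP _ _ pa); first by_fact.
  by apply: Cfc_fact; rewrite inE imset_f.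
Qed.

(** Separately the programs yield {a} and the empty set; together they are consistent and yield b
    too. *)
Lemma delta_not_FP5 (x : revision) : ~ FP5 (@delta x bool).
Proof.
pose A : program bool := [set fact pa].
pose B : program bool := [set pa ~> pb].
have conAB : consistent (set0 :|: (A :|: B)).
  by apply: (@consistent_seq _ _ [:: pa; pb]) => //; closed.
have sA : Cfc (A :|: set0) \subset [set l in [:: pa]].
  by apply: Cfc_sub_seq => //; closed.
have sB : Cfc (B :|: set0) \subset [set l in [::]].
  by apply: Cfc_sub_seq => //; closed.
have conA := consistent_sub_seq sA isT.
have conB := consistent_sub_seq sB isT.
have profA : profile [mset A] := profile1 (set11 _).
have profB : profile [mset B] := profile1 (set11 _).
move=> /(_ [mset A] [mset B] set0 profA profB).
rewrite /entails delta2 conAB !delta1 !Cfc_rev_consistent // Cfc_facts_Cfc.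
have sAB : Cfc (A :|: set0) :|: Cfc (B :|: set0) \subset [set l in [:: pa]].
  rewrite subUset sA; apply: subset_trans sB _.
  by apply/subsetP => l; rewrite !inE.
move=> /subset_trans/(_ (Cfc_facts_sub_seq sAB isT))/subsetP/(_ pb).
by rewrite !inE => H; apply: notF; apply: H; by_rule pa.
Qed.

(** The union is inconsistent, so the joint merging intersects {a} with the empty set and loses
    a. *)
Lemma delta_not_FP6 (x : revision) : ~ FP6 (@delta x bool).
Proof.
pose A : program bool := [set fact pa].
pose B : program bool := [set pa ~> na].
have sA : Cfc (A :|: set0) \subset [set l in [:: pa]].
  by apply: Cfc_sub_seq => //; closed.
have sB : Cfc (B :|: set0) \subset [set l in [::]].
  by apply: Cfc_sub_seq => //; closed.
have conA := consistent_sub_seq sA isT.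
have conB := consistent_sub_seq sB isT.
have profA : profile [mset A] := profile1 (set11 _).
have profB : profile [mset B] := profile1 (set11 _).
have sAB : Cfc (A :|: set0) :|: Cfc (B :|: set0) \subset [set l in [:: pa]].
  rewrite subUset sA; apply: subset_trans sB _.
  by apply/subsetP => l; rewrite !inE.
have sI : Cfc (A :|: set0) :&: Cfc (B :|: set0) \subset [set l in [::]].
  exact: subset_trans (subsetIr _ _) sB.
move=> /(_ [mset A] [mset B] set0 profA profB).
rewrite /entails delta2 ifN; last first.
  by apply: (@inconsistentP _ _ pa); [by_fact | by_rule pa].
rewrite !delta1 !Cfc_rev_consistent //.
move=> /(_ (consistent_sub_seq (Cfc_facts_sub_seq sAB isT) isT)).
move=> /subset_trans/(_ (Cfc_facts_sub_seq sI isT))/subsetP/(_ pa).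
rewrite inE => H; apply: notF; apply: H; apply: (subsetP (sub_Cfc_facts _)).
by rewrite inE; apply/orP; left; by_fact.
Qed.

Lemma delta_not_FP7 (x : revision) : ~ FP7 (@delta x bool).
Proof.
pose A : program bool := [set pa ~> pb].
pose Q : program bool := [set fact pa].
(* This closure is empty; the bound is widened to a list that also accommodates the fact of [Q]. *)
have sA : Cfc (A :|: set0) \subset [set l in [:: pa]].
  apply: (@subset_trans _ _ [set l in [::]]).
    by apply: Cfc_sub_seq => //; closed.
  by apply/subsetP => l; rewrite !inE.
have sAQ : Cfc (facts (Cfc (A :|: set0)) :|: Q) \subset [set l in [:: pa]].
  by apply: Cfc_factsU_sub_seq => //; closed.
have conA := consistent_sub_seq sA isT.
have conAQ : consistent (A :|: (set0 :|: Q)).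
  by apply: (@consistent_seq _ _ [:: pa; pb]) => //; closed.
have profA : profile [mset A] := profile1 (set11 _).
move=> /(_ [mset A] set0 Q profA).
rewrite /entails !delta1 !Cfc_rev_consistent // Cfc_facts_Cfc.
move=> /subset_trans/(_ sAQ)/subsetP/(_ pb).
by rewrite !inE => H; apply: notF; apply: H; by_rule pa.
Qed.

(** The set merged under [P] no longer carries the rule of [P], so b can be added to a consistently.
    With b in the constraint the rule fires and expels a. *)
Lemma delta_not_FP8 (x : revision) : ~ FP8 (@delta x bool).
Proof.
pose A : program bool := [set fact pa].
pose P : program bool := [set pb ~> na].
pose Q : program bool := [set fact pb].
have sA : Cfc (A :|: P) \subset [set l in [:: pa; pb]].
  apply: (@subset_trans _ _ [set l in [:: pa]]).
    by apply: Cfc_sub_seq => //; closed.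
  by apply/subsetP => l; rewrite !inE => ->.
have sAQ : Cfc (facts (Cfc (A :|: P)) :|: Q) \subset [set l in [:: pa; pb]].
  by apply: Cfc_factsU_sub_seq => //; closed.
have bad : ~~ consistent (fact pa |: (P :|: Q)).
  by apply: (@inconsistentP _ _ pa); [by_fact | by_rule pb].
have sPQ : Cfc (set0 :|: (P :|: Q)) \subset [set l in [:: pb; na]].
  by apply: Cfc_sub_seq => //; closed.
have eA : Cfc_rev x A (P :|: Q) = Cfc (set0 :|: (P :|: Q)).
  (* [A] is read as its only fact added to the empty program, which is what survives. *)
  by rewrite -[A]setU0 (Cfc_rev_drop x bad) ?(consistent_sub_seq sPQ).
have conA : consistent (A :|: P).
  by apply: (@consistent_seq _ _ [:: pa]) => //; closed.
have profA : profile [mset A] := profile1 (set11 _).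
move=> /(_ [mset A] P Q profA); rewrite /entails !delta1.
rewrite eA Cfc_rev_consistent // Cfc_facts_Cfc.
move=> /(_ (consistent_sub_seq sAQ isT)) /subset_trans/(_ sPQ)/subsetP/(_ pa).
rewrite !inE => H; apply: notF; apply: H; apply: Cfc_fact.
by rewrite inE; apply/orP; left; apply: imset_f; by_fact.
Qed.

Theorem theorem3 (x : revision) :
  (forall V : finType,
     FP0 (@delta x V) /\ FP1 (@delta x V) /\ FP2 (@delta x V)) /\
  (exists V : finType, ~ FP3 (@delta x V)) /\
  (exists V : finType, ~ FP4 (@delta x V)) /\
  (exists V : finType, ~ FP5 (@delta x V)) /\
  (exists V : finType, ~ FP6 (@delta x V)) /\
  (exists V : finType, ~ FP7 (@delta x V)) /\
  (exists V : finType, ~ FP8 (@delta x V)).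
Proof.
split; first by move=> V; split; [|split];
  [exact: delta_FP0 | exact: delta_FP1 | exact: delta_FP2].
split; first by exists bool; apply: delta_not_FP3.
split; first by exists bool; apply: delta_not_FP4.
split; first by exists bool; apply: delta_not_FP5.
split; first by exists bool; apply: delta_not_FP6.
split; first by exists bool; apply: delta_not_FP7.
by exists bool; apply: delta_not_FP8.
Qed.
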